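(* (Class Ia solutions.) Let $A>0$, $D>0$, $R>0$, $F$, $C$ be real constants, set $\Phi(r)=F-DR^2\left(1-\frac{r^2}{R^2}\right)^{1/2}$ and $e^{-\alpha}=1-\frac{r^2}{R^2}$, and let $I\subset(0,R)$ be an open interval. (1) If $A\neq\frac12$ and $(1-2A)\Phi>0$ on $I$, then $$e^{\omega}=\left[(1-2A)A^{A}\Phi\right]^{\frac{2}{1-2A}},\qquad Q=\pm\frac{\sqrt A\,Dr^3}{(1-2A)\Phi},$$ $$\kappa\rho=\frac3{R^2}-\frac{AD^2r^2}{(1-2A)^2\Phi^2},\qquad \kappa p=-\frac1{R^2}+\frac{AD^2r^2}{(1-2A)^2\Phi^2}+\frac{2D\left(1-\frac{r^2}{R^2}\right)^{1/2}}{(1-2A)\Phi}$$ is a solution on $I$ of the static spherically symmetric Einstein–Maxwell perfect fluid equations. (2) If $A=\frac12$, then $$\omega=\sqrt2\,\Phi,\qquad Q=\pm\frac{Dr^3}{2},\qquad \kappa\rho=\frac3{R^2}-\frac{D^2r^2}{4},\qquad \kappa p=-\frac1{R^2}+\frac{D^2r^2}{4}+\sqrt2\,D\left(1-\frac{r^2}{R^2}\right)^{1/2}$$ is a solution on $I$ of the same equations. In both cases the solution satisfies $\kappa\rho+\frac{Q^2}{r^4}=\frac3{R^2}$, and the electric potential $\phi$ satisfies the functional relation $Ae^{\omega}=(C+\phi)^2$.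
   Context: The metric is $ds^2=e^{\alpha(r)}dr^2+r^2(d\theta^2+\sin^2\theta\,d\varphi^2)-e^{\omega(r)}dt^2$, $p$ and $\rho$ are the (isotropic) matter pressure and density, $\phi(r)$ is the electric potential, $Q(r)=r^2\phi'e^{-\frac12(\alpha+\omega)}$ is the charge inside radius $r$, $\kappa>0$ is a constant and $'=d/dr$. The static spherically symmetric Einstein–Maxwell perfect fluid equations are $$\kappa p-\frac{Q^2}{r^4}=-\frac1{r^2}+\frac{e^{-\alpha}}{r^2}(1+r\omega'),$$ $$\kappa p+\frac{Q^2}{r^4}=e^{-\alpha}\left(\tfrac12\omega''-\tfrac14\alpha'\omega'+\tfrac14\omega'^2+\frac{\omega'-\alpha'}{2r}\right),$$ $$\kappa\rho+\frac{Q^2}{r^4}=\frac1{r^2}-\frac{e^{-\alpha}}{r^2}(1-r\alpha').$$ The sign $\pm$ in $Q$ corresponds to the two roots $\phi=-C\pm\sqrt A\,e^{\omega/2}$ of the functional relation. *)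

(* Defs.v *)
From Stdlib Require Import Reals.
From Coquelicot Require Import Coquelicot.

Open Scope R_scope.

(** The charge inside radius [r] of a potential [phi] in the metric
    e^alpha dr^2 + r^2 (dtheta^2 + sin^2 theta dvarphi^2) - e^omega dt^2. *)
Definition charge (alpha omega phi : R -> R) (r : R) : R :=
  r ^ 2 * Derive phi r * exp (- (1 / 2) * (alpha r + omega r)).

(** [Derive] is total, so the regularity needed for the derivatives in the
    equations to be meaningful is part of the notion of a solution. *)
Record EM_fluid_at (kappa : R) (alpha omega phi p rho : R -> R) (r : R)
  : Prop := {
  EM_ex_alpha' : ex_derive alpha r;
  EM_ex_omega' : ex_derive omega r;
  EM_ex_omega'' : ex_derive (Derive omega) r;
  EM_ex_phi' : ex_derive phi r;
  EM_eq1 :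
    kappa * p r - (charge alpha omega phi r) ^ 2 / r ^ 4 =
    - (1 / r ^ 2) + exp (- alpha r) / r ^ 2 * (1 + r * Derive omega r);
  EM_eq2 :
    kappa * p r + (charge alpha omega phi r) ^ 2 / r ^ 4 =
    exp (- alpha r) *
      (1 / 2 * Derive (Derive omega) r
       - 1 / 4 * Derive alpha r * Derive omega r
       + 1 / 4 * (Derive omega r) ^ 2
       + (Derive omega r - Derive alpha r) / (2 * r));
  EM_eq3 :
    kappa * rho r + (charge alpha omega phi r) ^ 2 / r ^ 4 =
    1 / r ^ 2 - exp (- alpha r) / r ^ 2 * (1 - r * Derive alpha r)
}.

(** Solution on the open interval (a, b). *)
Definition EM_fluid_solution (kappa a b : R) (alpha omega phi p rho : R -> R)
  : Prop :=
  forall r : R, a < r < b -> EM_fluid_at kappa alpha omega phi p rho r.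

(** Phi(r) = F - D R^2 (1 - r^2/R^2)^(1/2); the radius R is written [R0]. *)
Definition Phi (F D R0 r : R) : R :=
  F - D * R0 ^ 2 * sqrt (1 - r ^ 2 / R0 ^ 2).

(* Main.v *)
(** Both families are instances of one: writing [s = (1 - r^2/R0^2)^(1/2)], put
    [omega' = 2 r g / s] where [g] satisfies the Riccati equation
    [g' = (2 A - 1) r g^2 / s].  With [phi = - C + eps sqrt A e^(omega/2)] and
    [e^(-alpha) = s^2] this gives [Q = eps sqrt A r^3 g], and the field equations
    reduce to [kappa rho = 3/R0^2 - A g^2 r^2] and
    [kappa p = - 1/R0^2 + A g^2 r^2 + 2 g s].  As [Phi' = D r / s], the Riccati
    equation is solved by [g = D / ((1 - 2 A) Phi)], and by the constant
    [g = D / sqrt 2] when [A = 1/2]. *)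

Require Import Defs.
From Stdlib Require Import Reals Lra.
From Coquelicot Require Import Coquelicot.

Open Scope R_scope.

(** * Local calculus on an open interval: derivatives of [Phi] and [alpha] *)

Lemma locally_open_interval (a b r : R) (P : R -> Prop) :
  a < r < b -> (forall x, a < x < b -> P x) -> locally r P.
Proof.
intros hr H.
apply (filter_imp (fun x => a < x /\ x < b)); [exact H|].
apply filter_and; [apply (open_gt a)|apply (open_lt b)]; apply hr.
Qed.

(** The metric functions are prescribed only between [a] and [b]; since derivatives are local,
    closed formulas valid there can still be differentiated. *)
Lemma is_derive_ext_open_interval (a b r l : R) (f g : R -> R) :
  a < r < b -> (forall x, a < x < b -> f x = g x) ->
  is_derive g r l -> is_derive f r l.
Proof.
intros hr H Hg.
apply (is_derive_ext_loc g); [|exact Hg].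
apply (locally_open_interval a b); [exact hr|].
intros x hx; symmetry; auto.
Qed.

Lemma one_sub_sq_div_pos (R0 r : R) : 0 < r < R0 -> 0 < 1 - r ^ 2 / R0 ^ 2.
Proof.
intros hr.
replace (1 - r ^ 2 / R0 ^ 2) with ((R0 - r) * (R0 + r) / R0 ^ 2) by (field; lra).
apply Rdiv_lt_0_compat; [apply Rmult_lt_0_compat; lra|apply pow_lt; lra].
Qed.

Lemma is_derive_sqrt_one_sub_sq_div (R0 r : R) :
  0 < r < R0 ->
  is_derive (fun x => sqrt (1 - x ^ 2 / R0 ^ 2)) r
    (- r / (R0 ^ 2 * sqrt (1 - r ^ 2 / R0 ^ 2))).
Proof.
intros hr.
assert (h := one_sub_sq_div_pos R0 r hr).
assert (hs := sqrt_lt_R0 _ h).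
auto_derive.
- exact h.
- simpl in hs |- *; unfold Rminus, Rdiv in hs |- *.
  field; split; lra.
Qed.

Lemma is_derive_Phi (F D R0 r : R) :
  0 < r < R0 ->
  is_derive (Phi F D R0) r (D * r / sqrt (1 - r ^ 2 / R0 ^ 2)).
Proof.
intros hr.
assert (hs := sqrt_lt_R0 _ (one_sub_sq_div_pos R0 r hr)).
assert (Hs := is_derive_sqrt_one_sub_sq_div R0 r hr).
unfold Phi.
evar_last.
- apply (is_derive_minus (fun _ => F) (fun x => D * R0 ^ 2 * sqrt (1 - x ^ 2 / R0 ^ 2)));
    [apply is_derive_const|apply is_derive_scal, Hs].
- unfold minus, plus, opp, zero; simpl in hs |- *; unfold scal; simpl; unfold mult; simpl.
  field; split; lra.
Qed.

(** Only [exp (- alpha)] is given, so [alpha] is recovered on the interval as minus the logarithm of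
    a positive function. Its differentiability is thus derived rather than assumed. *)
Lemma is_derive_alpha (a b R0 r : R) (alpha : R -> R) :
  0 <= a -> b <= R0 ->
  (forall x, a < x < b -> exp (- alpha x) = 1 - x ^ 2 / R0 ^ 2) ->
  a < r < b ->
  is_derive alpha r (2 * r / (R0 ^ 2 * (1 - r ^ 2 / R0 ^ 2))).
Proof.
intros ha hb halpha hr.
assert (h : 0 < 1 - r ^ 2 / R0 ^ 2) by (apply one_sub_sq_div_pos; lra).
apply (is_derive_ext_open_interval a b r _ _ (fun x => - ln (1 - x ^ 2 / R0 ^ 2)) hr).
- intros x hx; rewrite <- halpha by exact hx; rewrite ln_exp; ring.
- auto_derive.
  + exact h.
  + simpl in h |- *; unfold Rminus, Rdiv in h |- *.
    field; split; [lra|]. nra.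
Qed.

(** * Field equations for the family generated by a Riccati function [g] *)

Section Riccati.

Variables (kappa A R0 C a b eps : R) (alpha omega p rho g : R -> R).
Hypotheses (hA : 0 < A) (ha : 0 <= a) (hb : b <= R0).
Hypothesis heps : eps = 1 \/ eps = -1.
Hypothesis halpha :
  forall r, a < r < b -> exp (- alpha r) = 1 - r ^ 2 / R0 ^ 2.

Let s (r : R) : R := sqrt (1 - r ^ 2 / R0 ^ 2).

Hypothesis homega :
  forall r, a < r < b -> is_derive omega r (2 * r * g r / s r).
Hypothesis hg :
  forall r, a < r < b -> is_derive g r ((2 * A - 1) * r * g r ^ 2 / s r).
Hypothesis hrho :
  forall r, a < r < b -> kappa * rho r = 3 / R0 ^ 2 - A * g r ^ 2 * r ^ 2.
Hypothesis hp :
  forall r, a < r < b ->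
  kappa * p r = - (1 / R0 ^ 2) + A * g r ^ 2 * r ^ 2 + 2 * g r * s r.

Let phi (r : R) : R := - C + eps * (sqrt A * exp (omega r / 2)).

Let s_pos (r : R) : a < r < b -> 0 < s r.
Proof.
intros hr; apply sqrt_lt_R0, one_sub_sq_div_pos; lra.
Qed.

Let s_sq (r : R) : a < r < b -> s r ^ 2 = 1 - r ^ 2 / R0 ^ 2.
Proof.
intros hr; apply pow2_sqrt, Rlt_le, one_sub_sq_div_pos; lra.
Qed.

Let eps_sqrtA_sq : (eps * sqrt A) ^ 2 = A.
Proof.
rewrite Rpow_mult_distr, pow2_sqrt by lra.
destruct heps as [-> | ->]; ring.
Qed.

Lemma is_derive_phi_riccati (r : R) :
  a < r < b ->
  is_derive phi r (eps * (sqrt A * (r * g r / s r * exp (omega r / 2)))).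
Proof.
intros hr.
assert (hs := s_pos r hr).
unfold phi; auto_derive.
- exists (2 * r * g r / s r); apply homega, hr.
- replace (Derive (fun x => omega x) r) with (2 * r * g r / s r)
    by (symmetry; apply is_derive_unique, homega, hr).
  unfold Rdiv; field; lra.
Qed.

(** The exponential [exp (omega / 2)] in [phi'] cancels against the weight in [charge], and
    [exp (- alpha / 2) = s] cancels the remaining [1 / s]. *)
Lemma charge_riccati (r : R) :
  a < r < b -> charge alpha omega phi r = eps * (sqrt A * r ^ 3 * g r).
Proof.
intros hr.
assert (hs := s_pos r hr).
unfold charge.
rewrite (is_derive_unique _ _ _ (is_derive_phi_riccati r hr)).
assert (E : exp (- alpha r / 2) = s r).
{ rewrite <- (sqrt_pow2 (exp _)) by apply Rlt_le, exp_pos.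
  unfold s; f_equal; rewrite <- halpha by exact hr.
  simpl; rewrite Rmult_1_r, <- exp_plus; f_equal; field. }
replace (- (1 / 2) * (alpha r + omega r)) with (- alpha r / 2 + - (omega r / 2)) by field.
rewrite exp_plus, E, exp_Ropp.
field; split; [apply Rgt_not_eq, exp_pos|lra].
Qed.

Lemma charge_sq_div_riccati (r : R) :
  a < r < b -> charge alpha omega phi r ^ 2 / r ^ 4 = A * g r ^ 2 * r ^ 2.
Proof.
intros hr.
rewrite charge_riccati by exact hr.
rewrite <- eps_sqrtA_sq at 2.
field; lra.
Qed.

(** The three terms come from differentiating the factors [r], [g] and [1 / s] of [omega']. The
    Riccati equation removes [g'], and [s' = - r / (R0 ^ 2 * s)]. *)
Lemma is_derive_Derive_omega_riccati (r : R) :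
  a < r < b ->
  is_derive (Derive omega) r
    (2 * g r / s r + 2 * r ^ 2 * ((2 * A - 1) * g r ^ 2) / s r ^ 2
     + 2 * r ^ 2 * g r / (R0 ^ 2 * s r ^ 3)).
Proof.
intros hr.
assert (hs := s_pos r hr).
apply (is_derive_ext_open_interval a b r _ _ (fun x => 2 * x * g x / s x) hr).
- intros x hx; apply is_derive_unique, homega, hx.
- assert (Hs : is_derive s r (- r / (R0 ^ 2 * s r)))
    by (apply is_derive_sqrt_one_sub_sq_div; lra).
  auto_derive.
  + repeat split; [exists ((2 * A - 1) * r * g r ^ 2 / s r); apply hg, hr
      |exists (- r / (R0 ^ 2 * s r)); exact Hs|lra].
  + replace (Derive (fun x => g x) r) with ((2 * A - 1) * r * g r ^ 2 / s r)
      by (symmetry; apply is_derive_unique, hg, hr).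
    replace (Derive (fun x => s x) r) with (- r / (R0 ^ 2 * s r))
      by (symmetry; apply is_derive_unique, Hs).
    field; split; [lra|]. nra.
Qed.

Lemma riccati_solution :
  exists psi : R -> R,
    EM_fluid_solution kappa a b alpha omega psi p rho /\
    (forall r : R, a < r < b ->
       charge alpha omega psi r = eps * (sqrt A * r ^ 3 * g r) /\
       kappa * rho r + (charge alpha omega psi r) ^ 2 / r ^ 4 = 3 / R0 ^ 2 /\
       A * exp (omega r) = (C + psi r) ^ 2 /\
       psi r = - C + eps * (sqrt A * exp (omega r / 2))).
Proof.
exists phi; split; intros r hr.
- assert (hs := s_pos r hr).
  assert (hs2 := s_sq r hr).
  assert (Ha := is_derive_alpha a b R0 r alpha ha hb halpha hr).
  rewrite <- hs2 in Ha.
  assert (Ho := homega r hr).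
  assert (Hoo := is_derive_Derive_omega_riccati r hr).
  assert (Hphi := is_derive_phi_riccati r hr).
  (* Solving for [1 / R0 ^ 2] turns the equations into identities in the
     independent quantities [r], [s r], [g r] and [A]. *)
  assert (hR : 1 / R0 ^ 2 = (1 - s r ^ 2) / r ^ 2) by (rewrite hs2; field; lra).
  constructor.
  + eexists; exact Ha.
  + eexists; exact Ho.
  + eexists; exact Hoo.
  + eexists; exact Hphi.
  + rewrite charge_sq_div_riccati, hp, halpha, <- hs2, (is_derive_unique _ _ _ Ho), hR
      by exact hr.
    field; lra.
  (* In the second equation the [1 / s ^ 3] term of [omega''] cancels against [alpha' omega']. The
     Riccati term, with factor [2 * A - 1], joins [omega' ^ 2 / 4] to give [2 * A * g ^ 2 * r ^ 2],
     twice the charge term; this fixes the Riccati coefficient. *)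
  + rewrite charge_sq_div_riccati, hp, halpha, <- hs2, (is_derive_unique _ _ _ Ho),
      (is_derive_unique _ _ _ Hoo), (is_derive_unique _ _ _ Ha) by exact hr.
    field; repeat split; lra.
  + rewrite charge_sq_div_riccati, hrho, halpha, <- hs2, (is_derive_unique _ _ _ Ha)
      by exact hr.
    (* The difference [(1 - s ^ 2) / r ^ 2] contributes [1 / R0 ^ 2] and the [alpha'] term
       contributes [2 / R0 ^ 2], whence the total [3 / R0 ^ 2]. *)
    replace (1 / r ^ 2) with (1 / R0 ^ 2 + s r ^ 2 / r ^ 2)
      by (rewrite hR; field; lra).
    field; repeat split; lra.
- split; [apply charge_riccati, hr|].
  split; [rewrite charge_sq_div_riccati, hrho by exact hr; ring|].
  split; [|reflexivity].
  unfold phi.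
  replace (C + _) with (eps * sqrt A * exp (omega r / 2)) by ring.
  rewrite Rpow_mult_distr, eps_sqrtA_sq.
  replace (omega r) with (omega r / 2 + omega r / 2) at 1 by field.
  rewrite exp_plus; ring.
Qed.

End Riccati.

(** * Specialisation of [g] to the cases [A <> 1 / 2] and [A = 1 / 2] *)

Theorem mainTheorem7
  (kappa A D R0 F C a b eps : R)
  (alpha omega p rho : R -> R)
  (hkappa : 0 < kappa) (hA : 0 < A) (hD : 0 < D) (hR0 : 0 < R0)
  (ha : 0 <= a) (hab : a < b) (hb : b <= R0)
  (heps : eps = 1 \/ eps = -1)
  (halpha : forall r : R, a < r < b -> exp (- alpha r) = 1 - r ^ 2 / R0 ^ 2) :
  (A <> 1 / 2 ->
   (forall r : R, a < r < b -> 0 < (1 - 2 * A) * Phi F D R0 r) ->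
   (forall r : R, a < r < b ->
      exp (omega r) =
      Rpower ((1 - 2 * A) * Rpower A A * Phi F D R0 r) (2 / (1 - 2 * A))) ->
   (forall r : R, a < r < b ->
      kappa * rho r =
      3 / R0 ^ 2
      - A * D ^ 2 * r ^ 2 / ((1 - 2 * A) ^ 2 * (Phi F D R0 r) ^ 2)) ->
   (forall r : R, a < r < b ->
      kappa * p r =
      - (1 / R0 ^ 2)
      + A * D ^ 2 * r ^ 2 / ((1 - 2 * A) ^ 2 * (Phi F D R0 r) ^ 2)
      + 2 * D * sqrt (1 - r ^ 2 / R0 ^ 2) / ((1 - 2 * A) * Phi F D R0 r)) ->
   exists phi : R -> R,
     EM_fluid_solution kappa a b alpha omega phi p rho /\
     (forall r : R, a < r < b ->
        charge alpha omega phi r =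
          eps * (sqrt A * D * r ^ 3 / ((1 - 2 * A) * Phi F D R0 r)) /\
        kappa * rho r + (charge alpha omega phi r) ^ 2 / r ^ 4 = 3 / R0 ^ 2 /\
        A * exp (omega r) = (C + phi r) ^ 2 /\
        phi r = - C + eps * (sqrt A * exp (omega r / 2))))
  /\
  (A = 1 / 2 ->
   (forall r : R, a < r < b -> omega r = sqrt 2 * Phi F D R0 r) ->
   (forall r : R, a < r < b ->
      kappa * rho r = 3 / R0 ^ 2 - D ^ 2 * r ^ 2 / 4) ->
   (forall r : R, a < r < b ->
      kappa * p r =
      - (1 / R0 ^ 2) + D ^ 2 * r ^ 2 / 4
      + sqrt 2 * D * sqrt (1 - r ^ 2 / R0 ^ 2)) ->
   exists phi : R -> R,
     EM_fluid_solution kappa a b alpha omega phi p rho /\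
     (forall r : R, a < r < b ->
        charge alpha omega phi r = eps * (D * r ^ 3 / 2) /\
        kappa * rho r + (charge alpha omega phi r) ^ 2 / r ^ 4 = 3 / R0 ^ 2 /\
        A * exp (omega r) = (C + phi r) ^ 2 /\
        phi r = - C + eps * (sqrt A * exp (omega r / 2)))).
Proof.
split.
- intros hA2 hPhi homega hrho hp.
  set (k := 1 - 2 * A) in *.
  assert (hk : k <> 0) by (unfold k; lra).
  assert (hPhi0 : forall r, a < r < b -> Phi F D R0 r <> 0).
  { intros r hr E; specialize (hPhi r hr); rewrite E in hPhi; lra. }
  (* After taking logarithms, the factor [Rpower A A] only shifts [omega] by a constant, so it drops
     out of [omega']. *)
  assert (homega' : forall r, a < r < b ->
      omega r = 2 / k * ln (k * Rpower A A * Phi F D R0 r)).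
  { intros r hr; rewrite <- (ln_exp (omega r)), homega by exact hr.
    unfold Rpower at 1; apply ln_exp. }
  destruct (riccati_solution kappa A R0 C a b eps alpha omega p rho
              (fun r => D / (k * Phi F D R0 r))) as [phi [Hsol H]];
    try assumption.
  + intros r hr.
    assert (hs : 0 < sqrt (1 - r ^ 2 / R0 ^ 2))
      by (apply sqrt_lt_R0, one_sub_sq_div_pos; lra).
    assert (HP : is_derive (Phi F D R0) r (D * r / sqrt (1 - r ^ 2 / R0 ^ 2)))
      by (apply is_derive_Phi; lra).
    assert (hAA : 0 < Rpower A A) by apply exp_pos.
    apply (is_derive_ext_open_interval a b r _ _ _ hr homega').
    auto_derive.
    (* The logarithm needs a positive argument: [k] and [Phi] may both be negative, but their
       product is positive by hypothesis. *)
    * split; [eexists; exact HP|split; [|exact I]].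
      replace (k * Rpower A A * Phi F D R0 r)
        with (k * Phi F D R0 r * Rpower A A) by ring.
      apply Rmult_lt_0_compat; auto.
    * replace (Derive (fun x => Phi F D R0 x) r)
        with (D * r / sqrt (1 - r ^ 2 / R0 ^ 2))
        by (symmetry; apply is_derive_unique, HP).
      field; repeat split; auto; lra.
  + intros r hr.
    assert (hs : 0 < sqrt (1 - r ^ 2 / R0 ^ 2))
      by (apply sqrt_lt_R0, one_sub_sq_div_pos; lra).
    assert (HP : is_derive (Phi F D R0) r (D * r / sqrt (1 - r ^ 2 / R0 ^ 2)))
      by (apply is_derive_Phi; lra).
    auto_derive.
    * split; [eexists; exact HP|split; [|exact I]].
      apply Rgt_not_eq, hPhi, hr.
    * replace (Derive (fun x => Phi F D R0 x) r)
        with (D * r / sqrt (1 - r ^ 2 / R0 ^ 2))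
        by (symmetry; apply is_derive_unique, HP).
      (* Here [g' = - D * Phi' / (k * Phi ^ 2) = - k * r * g ^ 2 / s]. *)
      replace (2 * A - 1) with (- k) by (unfold k; ring).
      field; repeat split; auto; lra.
  + intros r hr; rewrite hrho by exact hr.
    field; repeat split; auto; lra.
  + intros r hr; rewrite hp by exact hr.
    field; repeat split; auto; lra.
  + exists phi; split; [exact Hsol|].
    intros r hr; destruct (H r hr) as [HQ HH].
    split; [|exact HH].
    rewrite HQ; field; split; auto.
- intros hA2 homega hrho hp.
  assert (h2 : 0 < sqrt 2) by (apply sqrt_lt_R0; lra).
  assert (h22 : sqrt 2 ^ 2 = 2) by (apply pow2_sqrt; lra).
  (* The constant is read off from [omega' = sqrt 2 * D * r / s = 2 * r * g / s]. *)
  destruct (riccati_solution kappa A R0 C a b eps alpha omega p rho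
              (fun _ => sqrt 2 * D / 2)) as [phi [Hsol H]];
    try assumption.
  + intros r hr.
    assert (hs : 0 < sqrt (1 - r ^ 2 / R0 ^ 2))
      by (apply sqrt_lt_R0, one_sub_sq_div_pos; lra).
    apply (is_derive_ext_open_interval a b r _ _ _ hr homega).
    replace (2 * r * (sqrt 2 * D / 2) / sqrt (1 - r ^ 2 / R0 ^ 2))
      with (sqrt 2 * (D * r / sqrt (1 - r ^ 2 / R0 ^ 2))) by (field; lra).
    apply is_derive_scal, is_derive_Phi; lra.
  + intros r hr.
    replace (2 * A - 1) with 0 by lra.
    unfold Rdiv; rewrite !Rmult_0_l.
    apply @is_derive_const.
  + intros r hr; rewrite hrho, hA2 by exact hr.
    replace ((sqrt 2 * D / 2) ^ 2) with (sqrt 2 ^ 2 * D ^ 2 / 4) by field.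
    rewrite h22; field; lra.
  + intros r hr; rewrite hp, hA2 by exact hr.
    replace ((sqrt 2 * D / 2) ^ 2) with (sqrt 2 ^ 2 * D ^ 2 / 4) by field.
    rewrite h22; field; lra.
  + exists phi; split; [exact Hsol|].
    intros r hr; destruct (H r hr) as [HQ HH].
    split; [|exact HH].
    (* Since [2 * A = 1], the irrational factors of [sqrt A * g] cancel, leaving [D / 2]. *)
    assert (E : sqrt A * sqrt 2 = 1).
    { rewrite <- sqrt_mult by lra.
      replace (A * 2) with 1 by lra; apply sqrt_1. }
    rewrite HQ.
    replace (sqrt A * r ^ 3 * (sqrt 2 * D / 2))
      with (sqrt A * sqrt 2 * (D * r ^ 3 / 2)) by field.
    rewrite E; ring.
Qed.
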